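(* Let $0\leq m_r\leq d_r$, $0\leq m_f\leq d_f$ satisfy $d_r\geq d_f-m_f$ and $d_f\geq d_r-m_r$, and let $u\in S$. For $x\in S$ the following are equivalent: (a) $x\in Sol_{BDC}^{m_r,d_r,m_f,d_f}(u)\cap Sol_{RIC}^{m_r,d_r,m_f,d_f}(u)$; (b) for all $t\in\mathbb{R}$, $\overline{x(t-0)}\cdot x(t)=\overline{x(t-0)}\cdot\bigcap_{\xi\in[t-d_r,t-d_r+m_r]}u(\xi)$ and $x(t-0)\cdot\overline{x(t)}=x(t-0)\cdot\bigcap_{\xi\in[t-d_f,t-d_f+m_f]}\overline{u(\xi)}$.
   Context: $\mathbf{B}=\{0,1\}$ with Boolean operations $\cdot$ (and), complement $\overline{\ \cdot\ }$, ordered by $0<1$. $S$ is the set of signals: functions $x:\mathbb{R}\to\mathbf{B}$ for which there is a strictly increasing unbounded sequence $t_0<t_1<t_2<\dots$ of reals such that $x$ is constant on $(-\infty,t_0)$ and on each $[t_k,t_{k+1})$; $x(t-0)$ denotes the left limit of $x$ at $t$. For a bounded interval $I$ and $u\in S$, $\bigcap_{\xi\in I}u(\xi)$ equals $1$ iff $u(\xi)=1$ for all $\xi\in I$, and $\bigcup_{\xi\in I}u(\xi)$ equals $1$ iff $u(\xi)=1$ for some $\xi\in I$. For $0\leq m_r\leq d_r$, $0\leq m_f\leq d_f$ and $u\in S$, $Sol_{BDC}^{m_r,d_r,m_f,d_f}(u)$ is the set of $x\in S$ such that for all $t\in\mathbb{R}$: $\bigcap_{\xi\in[t-d_r,t-d_r+m_r]}u(\xi)\leq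 x(t)\leq\bigcup_{\xi\in[t-d_f,t-d_f+m_f]}u(\xi)$. For $0\leq\mu_r\leq\delta_r$, $0\leq\mu_f\leq\delta_f$ and $u\in S$, $Sol_{RIC}^{\mu_r,\delta_r,\mu_f,\delta_f}(u)$ is the set of $x\in S$ such that for all $t\in\mathbb{R}$: $\overline{x(t-0)}\cdot x(t)\leq\bigcap_{\xi\in[t-\delta_r,t-\delta_r+\mu_r]}u(\xi)$ and $x(t-0)\cdot\overline{x(t)}\leq\bigcap_{\xi\in[t-\delta_f,t-\delta_f+\mu_f]}\overline{u(\xi)}$. *)

(* Defs.v *)
From mathcomp Require Import all_boot all_order all_algebra.
From mathcomp Require Import all_classical all_reals all_analysis.

Set Implicit Arguments.
Unset Strict Implicit.
Unset Printing Implicit Defensive.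

Import Order.TTheory GRing.Theory Num.Theory.
Import numFieldNormedType.Exports.

Local Open Scope classical_set_scope.
Local Open Scope ring_scope.

Definition signal (R : realType) : set (R -> bool) :=
  [set x | exists tau : nat -> R,
    [/\ {homo tau : m n / (m < n)%N >-> m < n},
        ~ has_ubound (range tau),
        forall s t, s < tau 0%N -> t < tau 0%N -> x s = x t &
        forall k, {in `[tau k, tau k.+1[ &, forall s t, x s = x t}]].

(* x (t - 0); bool carries the discrete topology *)
Definition left_lim (R : realType) (x : R -> bool) (t : R) : bool :=
  lim (x s @[s --> t^'-]).

Definition bcap (R : realType) (I : interval R) (u : R -> bool) : bool :=
  `[< forall xi, xi \in I -> u xi >].

Definition bcup (R : realType) (I : interval R) (u : R -> bool) : bool :=
  `[< exists2 xi, xi \in I & u xi >].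

Definition Sol_BDC (R : realType) (mr dr mf df : R) (u : R -> bool) :
    set (R -> bool) :=
  [set x | signal x /\ forall t : R,
    (bcap `[t - dr, t - dr + mr] u <= x t)%O /\
    (x t <= bcup `[t - df, t - df + mf] u)%O].

Definition Sol_RIC (R : realType) (mur deltar muf deltaf : R) (u : R -> bool) :
    set (R -> bool) :=
  [set x | signal x /\ forall t : R,
    (~~ left_lim x t && x t <= bcap `[t - deltar, t - deltar + mur] u)%O /\
    (left_lim x t && ~~ x t
       <= bcap `[t - deltaf, t - deltaf + muf] (fun xi => ~~ u xi))%O].

(* Main.v *)
Require Import Defs.
From mathcomp Require Import all_boot all_order all_algebra.
From mathcomp Require Import all_classical all_reals all_analysis.

Import Order.TTheory GRing.Theory Num.Theory.
Import numFieldNormedType.Exports.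

Local Open Scope classical_set_scope.
Local Open Scope ring_scope.

(** The hypotheses [df - mf <= dr] and [dr - mr <= df] say exactly that the
    windows [[t - dr, t - dr + mr]] and [[t - df, t - df + mf]] meet, so [u] is
    never constantly [1] on the first and constantly [0] on the second.  As the
    union of [u] over the second window is the complement of the intersection
    of its complement, the equivalence then holds separately at each [t], by a
    truth table in [left_lim x t], [x t] and the two intersections. *)

Lemma bcupE (R : realType) (I : interval R) (u : R -> bool) :
  bcup I u = ~~ bcap I (fun xi => ~~ u xi).
Proof.
rewrite /bcup /bcap -asbool_neg; apply: asbool_equiv_eq; split.
  by move=> [xi Ixi uxi] /(_ xi Ixi); rewrite uxi.
move=> nall; apply: contrapT => nex; apply: nall => xi Ixi.
by apply/negP => uxi; apply: nex; exists xi.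
Qed.

Lemma bcap_compl_disjoint (R : realType) (I J : interval R) (u : R -> bool) xi :
  xi \in I -> xi \in J -> ~~ (bcap I u && bcap J (fun eta => ~~ u eta)).
Proof.
move=> Ixi Jxi; apply/negP => /andP[/asboolP uI /asboolP uJ].
by have := uJ _ Jxi; rewrite uI.
Qed.

Lemma itvcc_meet (R : realType) (a b c d : R) :
  a <= b -> c <= d -> a <= d -> c <= b ->
  Num.max a c \in `[a, b] /\ Num.max a c \in `[c, d].
Proof.
by move=> ab cd ad cb; rewrite !in_itv /= !le_max !ge_max !lexx ab cd ad cb orbT.
Qed.

Theorem theorem4p7 (R : realType) (mr dr mf df : R)
  (hmr : 0 <= mr) (hmrdr : mr <= dr) (hmf : 0 <= mf) (hmfdf : mf <= df)
  (hdr : df - mf <= dr) (hdf : dr - mr <= df)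
  (u : R -> bool) (hu : signal u) (x : R -> bool) (hx : signal x) :
  (Sol_BDC mr dr mf df u `&` Sol_RIC mr dr mf df u) x <->
  (forall t : R,
     (~~ left_lim x t && x t
        = ~~ left_lim x t && bcap `[t - dr, t - dr + mr] u) /\
     (left_lim x t && ~~ x t
        = left_lim x t && bcap `[t - df, t - df + mf] (fun xi => ~~ u xi))).
Proof.
have disj t : ~~ (bcap `[t - dr, t - dr + mr] u &&
    bcap `[t - df, t - df + mf] (fun xi => ~~ u xi)).
  have [|||| rI fI] := @itvcc_meet R (t - dr) (t - dr + mr) (t - df) (t - df + mf).
  - by rewrite lerDl.
  - by rewrite lerDl.
  (* Once [t] cancels, the two crossed endpoint inequalities are [hdr] and [hdf]. *)
  - by rewrite -addrA lerD2l lerNl opprD opprK.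
  - by rewrite -addrA lerD2l lerNl opprD opprK.
  exact: bcap_compl_disjoint rI fI.
split=> [[[_ bdc] [_ ric]] t | eqs].
  (* In each equation, [ric] gives [<=] and [bdc] gives [>=]. *)
  move: (bdc t) (ric t) (disj t); rewrite bcupE !leEbool.
  by do 2![case: (bcap _ _)]; case: (left_lim x t); case: (x t) => -[? ?] [].
(* If [left_lim x t] is [false], the first equation determines [x t], otherwise the second does;
   [disj] then gives the bound of [Sol_BDC] that involves the other window. *)
split; split=> // t; move: (eqs t) (disj t); rewrite ?bcupE !leEbool;
  by do 2![case: (bcap _ _)]; case: (left_lim x t); case: (x t) => -[].
Qed.
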